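(* $n^{-5/8}$ is a distance threshold for $G(n,r)$ to be planar: if $r=o(n^{-5/8})$ then w.h.p. $G(n,r)$ is planar, and if $r=\omega(n^{-5/8})$ then w.h.p. $G(n,r)$ is not planar.
   Context: The random geometric graph $G(n,r)$ is formed by choosing $n$ points independently and uniformly at random in the unit square $[0,1]^2$; two points are joined by a straight-line edge iff their Euclidean distance is at most $r$, where $r=r(n)\to 0$ as $n\to\infty$. ''W.h.p.'' means with probability tending to $1$ as $n\to\infty$. Planar is meant in the usual graph-theoretic sense. *)

(* Defs.v *)
From HB Require Import structures.
From mathcomp Require Import all_boot all_order all_algebra.
From mathcomp Require Import all_classical all_reals all_analysis.
Set Implicit Arguments. Unset Strict Implicit. Unset Printing Implicit Defensive.
Import Order.TTheory GRing.Theory Num.Theory.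
Import numFieldNormedType.Exports.
Local Open Scope classical_set_scope.
Local Open Scope ring_scope.

(* Planar embedding of a simple graph with vertex set 'I_n and symmetric edge
   relation [adj]: distinct points for the vertices, and for each edge {i,j}
   (recorded once, with i < j) a simple arc gam i j : [0,1] -> R^2 from the
   image of i to the image of j, such that an arc passes through no vertex
   other than its endpoints and two distinct arcs meet only at common
   endpoints. *)
Definition planar_embedding (R : realType) (n : nat) (adj : 'I_n -> 'I_n -> Prop)
  (f : 'I_n -> R * R) (gam : 'I_n -> 'I_n -> R -> R * R) : Prop :=
  injective f /\
  (forall i j : 'I_n, (i < j)%N -> adj i j ->
     [/\ {within `[0, 1], continuous gam i j},
         gam i j 0 = f i, gam i j 1 = f j,
         {in `[0, 1] &, injective (gam i j)} &
         forall (v : 'I_n) (t : R), t \in `[0, 1] -> gam i j t = f v ->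
           v = i \/ v = j]) /\
  (forall i j k l : 'I_n, (i < j)%N -> adj i j -> (k < l)%N -> adj k l ->
     (i, j) <> (k, l) ->
     forall t s : R, t \in `[0, 1] -> s \in `[0, 1] ->
       gam i j t = gam k l s ->
       exists v : 'I_n, (v = i \/ v = j) /\ (v = k \/ v = l) /\ gam i j t = f v).

Definition planar (R : realType) (n : nat) (adj : 'I_n -> 'I_n -> Prop) : Prop :=
  exists f gam, @planar_embedding R n adj f gam.

Definition dist2 (R : realType) (p q : R * R) : R :=
  Num.sqrt ((p.1 - q.1) ^+ 2 + (p.2 - q.2) ^+ 2).

(* A configuration of n points is encoded by a list s of 2n reals:
   point i is (s_{2i}, s_{2i+1}). *)
Definition point (R : realType) (s : seq R) (i : nat) : R * R :=
  (nth 0 s (2 * i), nth 0 s (2 * i).+1).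

Definition geom_adj (R : realType) (n : nat) (r : R) (s : seq R) :
  'I_n -> 'I_n -> Prop :=
  fun i j => i <> j /\ dist2 (point s i) (point s j) <= r.

Fixpoint cube_int (R : realType) (k : nat) (F : seq R -> \bar R) : \bar R :=
  match k with
  | 0 => F [::]
  | k'.+1 => (\int[@lebesgue_measure R]_(x in `[0%R, 1%R]) cube_int k' (fun s => F (x :: s)))%E
  end.

(* Probability that G(n,r) (n i.i.d. uniform points in [0,1]^2) is planar. *)
Definition prob_planar (R : realType) (n : nat) (r : R) : \bar R :=
  cube_int (2 * n) (fun s => (\1_[set s | @planar R n (@geom_adj R n r s)] s)%:E).

(* Main.v *)
Require Import Defs.
From HB Require Import structures.
From mathcomp Require Import all_boot all_order all_algebra.
From mathcomp Require Import all_classical all_reals all_analysis.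
From mathcomp Require Import measurable_realfun zify ring lra.
Set Implicit Arguments. Unset Strict Implicit. Unset Printing Implicit Defensive.
Import Order.TTheory GRing.Theory Num.Theory.
Import numFieldNormedType.Exports.
Import Defs.
Local Open Scope classical_set_scope.
Local Open Scope ring_scope.

(* Divide the unit square into m^2 equal cells. The event that G(n,r) is planar
   is sandwiched between events depending only on the cells of the points, so
   that its probability is compared with those of an occupancy problem: n balls
   thrown independently and uniformly into m^2 bins.

   If r = o(n^(-5/8)), take cells of side slightly larger than 4 r. The expected
   number of 3 x 3 blocks containing five points is O(n^5 m^(-8)) = o(1). If no
   such block exists, every component has at most four vertices, and a disjoint
   union of copies of K_4 is planar.

   If r = omega(n^(-5/8)), take cells of side at most r / 2, so that five points
   in one cell span a K_5. Split the points into five groups and count the cells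
   hit by every group. Hits of two distinct cells are negatively correlated, so
   Chebyshev's inequality shows that w.h.p. such a cell exists.

   K_5 is not planar: for disjoint arcs p and q the difference p(s) - q(t) never
   vanishes on the unit square, hence has winding number zero along its
   boundary. Modulo 2 this relates the winding numbers of edges around vertices;
   in the sum of the relations over the fifteen pairs of disjoint edges all
   winding numbers cancel and 1 = 0 remains. *)

(** * Winding numbers modulo 2 of polygons *)

Lemma addb_telescope (g : nat -> bool) n :
  \big[addb/false]_(i < n) (g i (+) g i.+1) = g 0%N (+) g n.
Proof.
elim: n => [|n IH]; first by rewrite big_ord0 addbb.
by rewrite big_ord_recr /= IH -addbA addKb.
Qed.

(* [A] and [B] are the values of a mod 2 cochain on the horizontal and vertical
   edges of an [n] x [n] grid. *)
Lemma grid_boundary_parity (A B : nat -> nat -> bool) n :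
  (forall i j, (i < n)%N -> (j < n)%N ->
     A i j (+) A i j.+1 = B i j (+) B i.+1 j) ->
  \big[addb/false]_(i < n) A i 0%N (+) \big[addb/false]_(i < n) A i n =
  \big[addb/false]_(j < n) B 0%N j (+) \big[addb/false]_(j < n) B n j.
Proof.
move=> AB; rewrite -(addb_telescope (fun j => \big[addb/false]_(i < n) A i j)).
rewrite -big_split /=; apply: eq_bigr => j _; rewrite -big_split /=.
rewrite -(addb_telescope (fun i => B i j)).
by apply: eq_bigr => i _; exact: AB.
Qed.

Section Winding.
Variable R : realType.
Implicit Types (u v w : R * R) (p q : nat -> R * R).

(* Ties are broken so that exactly one of [u], [- u] is positive as soon as
   [u <> 0]. *)
Definition lexpos (a b : R) := (0 < a) || ((a == 0) && (0 < b)).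
Definition up u := lexpos u.2 u.1.
Definition lft u := ~~ lexpos u.1 u.2.

(* For consecutive points of a fine polygon around the origin this detects the
   crossings of the negative half-axis, so that its sum over the polygon is the
   winding number modulo 2. *)
Definition cross u w := lft u && (up u (+) up w).

Lemma lexposN a b : (a, b) <> 0 -> lexpos (- a) (- b) = ~~ lexpos a b.
Proof.
rewrite /lexpos !oppr_gt0 oppr_eq0 => ab.
case: (ltgtP a 0) => //= a0; case: (ltgtP b 0) => //= b0.
by case: ab; rewrite a0 b0.
Qed.

Lemma upN u : u <> 0 -> up (- u) = ~~ up u.
Proof.
case: u => a b ab; rewrite /up /= lexposN // => -[b0 a0].
by apply: ab; rewrite a0 b0.
Qed.

Lemma lftN u : u <> 0 -> lft (- u) = ~~ lft u.
Proof. by case: u => a b ab; rewrite /lft /= lexposN. Qed.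

(** Each change of [up] crosses the negative or the positive half-axis. Negating both vectors
    exchanges the two, so both counts together give all changes of [up]. *)
Lemma crossN u w : u <> 0 -> w <> 0 ->
  cross (- u) (- w) = cross u w (+) (up u (+) up w).
Proof.
move=> u0 w0; rewrite /cross lftN // !upN //.
by case: (lft u); case: (up u); case: (up w).
Qed.

(** The arguments are the differences at the corners of a grid cell. Lying on one side of an axis,
    they cannot turn around the origin. *)
Definition good_cell u00 u10 u01 u11 :=
  [/\ up u00 = up u10, up u00 = up u01 & up u00 = up u11] \/
  [/\ lft u00 = lft u10, lft u00 = lft u01 & lft u00 = lft u11].

Lemma good_cell_cross u00 u10 u01 u11 : good_cell u00 u10 u01 u11 ->
  cross u00 u10 (+) cross u01 u11 = cross u00 u01 (+) cross u10 u11.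
Proof.
rewrite /cross => -[] []; first by move=> <- <- <-; rewrite addbb !andbF.
by move=> <- <- _; case: (lft u00); case: (up u00); case: (up u10); case: (up u01); case: (up u11).
Qed.

(** For a polygon that is not closed this is the parity of its crossings of the horizontal ray to
    the left of [v]. *)
Definition winding n p v := \big[addb/false]_(i < n) cross (p i - v) (p i.+1 - v).

(** On the two sides of the square where the first arc is fixed, the differences have the opposite
    sign; the corrections of [crossN] telescope to the endpoints. *)
Lemma winding_opp n p v : (forall i, (i <= n)%N -> v <> p i) ->
  \big[addb/false]_(i < n) cross (v - p i) (v - p i.+1) =
  winding n p v (+) (up (p 0%N - v) (+) up (p n - v)).
Proof.
move=> vp; rewrite -(addb_telescope (fun i => up (p i - v))) -big_split /=.
have nz i : (i <= n)%N -> p i - v <> 0.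
  by move=> /vp + /eqP; rewrite subr_eq0 => + /eqP e; rewrite e.
apply: eq_bigr => i _; rewrite -(opprB (p i)) -(opprB (p i.+1)).
by rewrite crossN //; apply: nz; rewrite // ltnW.
Qed.

(** Boundary parity for the differences [p i - q j]: two sides of the square give [p] around the
    ends of [q], the other two give [q] around the ends of [p] up to sign. *)
Lemma winding_square n p q :
  (forall i, (i <= n)%N -> p 0%N <> q i) ->
  (forall i, (i <= n)%N -> p n <> q i) ->
  (forall i j, (i < n)%N -> (j < n)%N ->
     good_cell (p i - q j) (p i.+1 - q j) (p i - q j.+1) (p i.+1 - q j.+1)) ->
  winding n p (q 0%N) (+) winding n p (q n) =
  (winding n q (p 0%N) (+) (up (q 0%N - p 0%N) (+) up (q n - p 0%N))) (+)
  (winding n q (p n) (+) (up (q 0%N - p n) (+) up (q n - p n))).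
Proof.
move=> p0 pn good; rewrite -!winding_opp //.
apply: (@grid_boundary_parity (fun i j => cross (p i - q j) (p i.+1 - q j))
   (fun i j => cross (p i - q j) (p i - q j.+1))) => i j lti ltj.
exact/good_cell_cross/good.
Qed.

End Winding.

(** * Continuous arcs and their fine subdivisions *)

Section Arcs.
Variable R : realType.
Implicit Types (a b : R -> R) (p q : R -> R * R).

Lemma within_eps_delta a s0 (e : R) :
  {within `[0, 1], continuous a} -> s0 \in `[0, 1] -> 0 < e ->
  exists2 d : R, 0 < d &
    forall s, s \in `[0, 1] -> `|s - s0| < d -> `|a s - a s0| < e.
Proof.
move=> /subspace_continuousP ac s01 e0.
have := ac s0 s01; move=> /cvgr_dist_lt /(_ _ e0) /=.
rewrite /within /= => -[d /= d0 H]; exists d => // s s1 sd.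
by rewrite distrC; apply: H => //=; rewrite distrC.
Qed.

Lemma sub_sign_locally_constant a b s0 t0 :
  {within `[0, 1], continuous a} -> {within `[0, 1], continuous b} ->
  s0 \in `[0, 1] -> t0 \in `[0, 1] -> a s0 != b t0 ->
  exists2 d : R, 0 < d & forall s t, s \in `[0, 1] -> t \in `[0, 1] ->
    `|s - s0| < d -> `|t - t0| < d ->
    a s != b t /\ (b t < a s) = (b t0 < a s0).
Proof.
move=> ac bc s01 t01 ab.
have e0 : 0 < `|a s0 - b t0| / 2 by rewrite divr_gt0 // normr_gt0 subr_eq0.
have [d d0 Hd] := within_eps_delta ac s01 e0.
have [d' d'0 Hd'] := within_eps_delta bc t01 e0.
exists (Num.min d d'); first by rewrite lt_min d0.
move=> s t s1 t1; rewrite !lt_min => /andP[sd _] /andP[_ td].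
have {}Hd := Hd _ s1 sd; have {}Hd' := Hd' _ t1 td.
move: Hd Hd' e0; rewrite !ltr_norml.
case: (ltgtP (b t0) (a s0)) ab => [lt|lt|->]; rewrite ?eqxx // => _.
  rewrite (@ger0_norm _ (a s0 - b t0)); last by rewrite subr_ge0 ltW.
  move=> /andP[? ?] /andP[? ?] ?; have h : b t < a s by lra.
  by rewrite h gt_eqF.
rewrite (@ler0_norm _ (a s0 - b t0)); last by rewrite subr_le0 ltW.
move=> /andP[? ?] /andP[? ?] ?; have ? : a s < b t by lra.
by rewrite lt_eqF //; split=> //; apply/negbTE; rewrite -leNgt ltW.
Qed.

Lemma lexpos_sub_locally_constant a b a' b' s0 t0 :
  {within `[0, 1], continuous a} -> {within `[0, 1], continuous b} ->
  s0 \in `[0, 1] -> t0 \in `[0, 1] -> a s0 != b t0 ->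
  exists2 d : R, 0 < d & forall s t, s \in `[0, 1] -> t \in `[0, 1] ->
    `|s - s0| < d -> `|t - t0| < d ->
    lexpos (a s - b t) (a' s - b' t) = (b t0 < a s0).
Proof.
move=> ac bc s01 t01 /(sub_sign_locally_constant ac bc s01 t01)[d d0 H].
exists d => // s t s1 t1 sd td; have [ne <-] := H s t s1 t1 sd td.
by rewrite /lexpos subr_eq0 (negbTE ne) orbF subr_gt0.
Qed.

(** Distinct points differ in some coordinate, whose difference keeps its sign nearby: the first
    coordinate then fixes [lft], the second fixes [up]. *)
Lemma good_cell_locally p q s0 t0 :
  {within `[0, 1], continuous p} -> {within `[0, 1], continuous q} ->
  s0 \in `[0, 1] -> t0 \in `[0, 1] -> p s0 <> q t0 ->
  exists2 d : R, 0 < d & forall s t s' t',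
    s \in `[0, 1] -> t \in `[0, 1] -> s' \in `[0, 1] -> t' \in `[0, 1] ->
    `|s - s0| < d -> `|t - t0| < d -> `|s' - s0| < d -> `|t' - t0| < d ->
    good_cell (p s - q t) (p s' - q t) (p s - q t') (p s' - q t').
Proof.
move=> pc qc s01 t01 pq.
have c1 (g : R -> R * R) : {within `[0, 1], continuous g} ->
    {within `[0, 1], continuous (fun s => (g s).1)}.
  by move=> gc x; apply: continuous_comp; [exact: gc|exact: cvg_fst].
have c2 (g : R -> R * R) : {within `[0, 1], continuous g} ->
    {within `[0, 1], continuous (fun s => (g s).2)}.
  by move=> gc x; apply: continuous_comp; [exact: gc|exact: cvg_snd].
have [e1|n1] := eqVneq (p s0).1 (q t0).1; last first.
  have [d d0 H] := lexpos_sub_locally_constant (fun s => (p s).2)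
    (fun t => (q t).2) (c1 _ pc) (c1 _ qc) s01 t01 n1.
  exists d => // s t s' t' *; right.
  by rewrite /lft /= !H.
have [e2|n2] := eqVneq (p s0).2 (q t0).2.
  by case: pq; rewrite (surjective_pairing (p s0)) e1 e2 -surjective_pairing.
have [d d0 H] := lexpos_sub_locally_constant (fun s => (p s).1)
  (fun t => (q t).1) (c2 _ pc) (c2 _ qc) s01 t01 n2.
exists d => // s t s' t' *; left.
by rewrite /up /= !H.
Qed.

(** Compactness of the unit square turns the local radii into one mesh for all cells. *)
Lemma good_cell_near p q :
  {within `[0, 1], continuous p} -> {within `[0, 1], continuous q} ->
  (forall s t, s \in `[0, 1] -> t \in `[0, 1] -> p s <> q t) ->
  \forall n \near \oo, forall s t s' t',
    s \in `[0, 1] -> t \in `[0, 1] -> s' \in `[0, 1] -> t' \in `[0, 1] ->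
    `|s' - s| <= n.+1%:R^-1 -> `|t' - t| <= n.+1%:R^-1 ->
    good_cell (p s - q t) (p s' - q t) (p s - q t') (p s' - q t').
Proof.
move=> pc qc pq.
have /compact_near_coveringP/near_covering_withinP cov :
    compact ((`[0, 1] : set R) `*` (`[0, 1] : set R)).
  by apply: compact_setX; exact: segment_compact.
pose good n (z : R * R) := forall s' t', s' \in `[0, 1] -> t' \in `[0, 1] ->
  `|s' - z.1| <= n.+1%:R^-1 -> `|t' - z.2| <= n.+1%:R^-1 ->
  good_cell (p z.1 - q z.2) (p s' - q z.2) (p z.1 - q t') (p s' - q t').
suff : \forall n \near \oo, (`[0, 1] : set R) `*` (`[0, 1] : set R) `<=` good n.
  by apply: filterS => n Hn s t s' t' s1 t1; exact: (Hn (s, t)).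
apply: cov => -[s0 t0] [/= s01 t01].
have [d d0 Hd] := good_cell_locally pc qc s01 t01 (pq _ _ s01 t01).
(* Half the radius is spent on the distance to the centre, half on one step of the mesh. *)
have d20 : 0 < d / 2 by rewrite divr_gt0.
near=> z n => -[/= z1 z2] s' t' s1 t1 sz tz.
have [zs zt] : `|z.1 - s0| < d / 2 /\ `|z.2 - t0| < d / 2.
  have [] : ball s0 (d / 2) z.1 /\ ball t0 (d / 2) z.2.
    by near: z; exact: nbhsx_ballx.
  by rewrite /ball /= => ? ?; rewrite !(distrC _ s0) !(distrC _ t0).
have nd : n.+1%:R^-1 < d / 2 by near: n; exact: (near_infty_natSinv_lt (PosNum d20)).
apply: Hd => //.
- lra.
- lra.
- by apply: le_lt_trans (ler_distD z.1 _ _) _; rewrite [ltRHS]splitr ltrD // (le_lt_trans sz).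
- by apply: le_lt_trans (ler_distD z.2 _ _) _; rewrite [ltRHS]splitr ltrD // (le_lt_trans tz).
Unshelve. all: by end_near. Qed.

(** There are [n.+1] steps, so that the denominator never vanishes. *)
Definition sample (n : nat) p (i : nat) := p (i%:R / n.+1%:R).

Lemma sample0 n p : sample n p 0 = p 0.
Proof. by rewrite /sample mul0r. Qed.

Lemma sample_last n p : sample n p n.+1 = p 1.
Proof. by rewrite /sample divff // pnatr_eq0. Qed.

Lemma sample_point_in n i : (i <= n.+1)%N -> (i%:R / n.+1%:R : R) \in `[0, 1].
Proof.
move=> le; rewrite in_itv /= divr_ge0 //= ler_pdivrMr ?ltr0n // mul1r.
by rewrite ler_nat.
Qed.

(** Stated for all large [n], so that finitely many pairs of arcs can share one subdivision. *)
Lemma winding_disjoint_arcs p q :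
  {within `[0, 1], continuous p} -> {within `[0, 1], continuous q} ->
  (forall s t, s \in `[0, 1] -> t \in `[0, 1] -> p s <> q t) ->
  \forall n \near \oo,
    winding n.+1 (sample n p) (q 0) (+) winding n.+1 (sample n p) (q 1) =
    (winding n.+1 (sample n q) (p 0) (+) (up (q 0 - p 0) (+) up (q 1 - p 0))) (+)
    (winding n.+1 (sample n q) (p 1) (+) (up (q 0 - p 1) (+) up (q 1 - p 1))).
Proof.
move=> pc qc pq; apply: filterS (good_cell_near pc qc pq) => n good.
rewrite -!(sample0 n) -!(sample_last n); apply: winding_square.
- by move=> i /sample_point_in ?; apply: pq; rewrite // sample_point_in.
- by move=> i /sample_point_in ?; apply: pq; rewrite // sample_point_in.
have dist i : `|i.+1%:R / n.+1%:R - i%:R / n.+1%:R : R| <= n.+1%:R^-1.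
  by rewrite -mulrBl -natrB // subSnn mul1r ger0_norm // invr_ge0.
move=> i j lti ltj; apply: good => //; rewrite sample_point_in //; exact: ltnW.
Qed.

End Arcs.

(** * Nonplanarity of K_5 *)

(* Each winding number is counted twice in the sum of the fifteen relations, so
   the parity is decided by the five interleaved pairs of edges. *)
Lemma K5_parity (W : nat -> nat -> nat -> bool) (U : nat -> nat -> bool) :
  (forall a b, (a < b < 5)%N -> U b a = ~~ U a b) ->
  ~ (forall a b c d, (a < b < 5)%N -> (c < d < 5)%N ->
       [&& a != c, a != d, b != c & b != d] ->
       W c a b (+) W d a b =
       (W a c d (+) (U c a (+) U d a)) (+) (W b c d (+) (U c b (+) U d b))).
Proof.
move=> HU HW.
(* Exclusive or is restated as evenness of a sum of natural numbers, so that linear arithmetic can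
   add the relations. *)
have parity a b c d : (a < b < 5)%N -> (c < d < 5)%N ->
    [&& a != c, a != d, b != c & b != d] -> exists k : nat,
    (W c a b + W d a b + W a c d + W b c d + U c a + U d a + U c b + U d b
       = k + k :> nat)%N.
  move=> ab cd ne; have {ab cd ne}E := HW _ _ _ _ ab cd ne.
  exists (W c a b + W d a b + W a c d + W b c d + U c a + U d a + U c b + U d b)./2.
  rewrite addnn -[LHS]odd_double_half !oddD !oddb -[RHS]add0n; congr (_ + _)%N.
  move: E; case: (W c a b); case: (W d a b); case: (W a c d); case: (W b c d);
  by case: (U c a); case: (U d a); case: (U c b); case: (U d b).
have U1 a b : (a < b < 5)%N -> (U b a + U a b = 1 :> nat)%N.
  by move=> /HU ->; case: (U a b).
have [k0 e0] := parity 0 1 2 3 isT isT isT.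
have [k1 e1] := parity 0 1 2 4 isT isT isT.
have [k2 e2] := parity 0 1 3 4 isT isT isT.
have [k3 e3] := parity 0 2 1 3 isT isT isT.
have [k4 e4] := parity 0 2 1 4 isT isT isT.
have [k5 e5] := parity 0 2 3 4 isT isT isT.
have [k6 e6] := parity 0 3 1 2 isT isT isT.
have [k7 e7] := parity 0 3 1 4 isT isT isT.
have [k8 e8] := parity 0 3 2 4 isT isT isT.
have [k9 e9] := parity 0 4 1 2 isT isT isT.
have [k10 e10] := parity 0 4 1 3 isT isT isT.
have [k11 e11] := parity 0 4 2 3 isT isT isT.
have [k12 e12] := parity 1 2 3 4 isT isT isT.
have [k13 e13] := parity 1 3 2 4 isT isT isT.
have [k14 e14] := parity 1 4 2 3 isT isT isT.
have := (f_equal2 addn e0 (f_equal2 addn e1 (f_equal2 addn e2 (f_equal2 addn e3 (f_equal2 addn e4 (f_equal2 addn e5 (f_equal2 addn e6 (f_equal2 addn e7 (f_equal2 addn e8 (f_equal2 addn e9 (f_equal2 addn e10 (f_equal2 addn e11 (f_equal2 addn e12 (f_equal2 addn e13 e14)))))))))))))).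
have h01 := U1 0 1 isT; have h02 := U1 0 2 isT; have h03 := U1 0 3 isT; have h04 := U1 0 4 isT; have h12 := U1 1 2 isT; have h13 := U1 1 3 isT; have h14 := U1 1 4 isT; have h23 := U1 2 3 isT; have h24 := U1 2 4 isT; have h34 := U1 3 4 isT.
move: h01 h02 h03 h04 h12 h13 h14 h23 h24 h34 => {e0 e1 e2 e3 e4 e5 e6 e7 e8 e9 e10 e11 e12 e13 e14 parity HU HW U1}.
(* The 30 values of [W] and the 20 values of [U] become arbitrary natural numbers. *)
do 50?move: (nat_of_bool _) => ?.
lia.
Qed.

(** The vertices are listed in increasing order because an embedding records each edge only from its
    smaller to its larger end. *)
Lemma K5_not_planar (R : realType) (n : nat) (adj : 'I_n -> 'I_n -> Prop)
    (v : nat -> 'I_n) :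
  (forall a b, (a < b < 5)%N -> (v a < v b)%N /\ adj (v a) (v b)) ->
  ~ planar R adj.
Proof.
move=> clique [f [gam [finj [arc disj]]]].
have arcv a b (ab : (a < b < 5)%N) := arc _ _ (clique _ _ ab).1 (clique _ _ ab).2.
have vinj a b : (a < 5)%N -> (b < 5)%N -> a != b -> v a <> v b.
  move=> a5 b5; case: ltngtP => // [ab|ba] _ e.
    by have := (clique a b); rewrite ab b5 e ltnn => /(_ isT) [].
  by have := (clique b a); rewrite ba a5 e ltnn => /(_ isT) [].
pose W N c a b := winding N.+1 (sample N (gam (v a) (v b))) (f (v c)).
pose U a b := up (f (v a) - f (v b)).
have rel a b c d : (a < b < 5)%N -> (c < d < 5)%N ->
    [&& a != c, a != d, b != c & b != d] -> \forall N \near \oo,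
    W N c a b (+) W N d a b =
    (W N a c d (+) (U c a (+) U d a)) (+) (W N b c d (+) (U c b (+) U d b)).
  move=> ab cd /and4P[ac ad bc bd].
  have [abc ab0 ab1 _ _] := arcv a b ab; have [cdc cd0 cd1 _ _] := arcv c d cd.
  rewrite /W /U -ab0 -ab1 -cd0 -cd1; apply: winding_disjoint_arcs => // s t s1 t1 e.
  have ne : (v a, v b) <> (v c, v d) by move=> [+ _]; apply: vinj => //; lia.
  have [w [wab [wcd _]]] := disj _ _ _ _ (clique _ _ ab).1 (clique _ _ ab).2
    (clique _ _ cd).1 (clique _ _ cd).2 ne _ _ s1 t1 e.
  by case: wab wcd => -> []; apply: vinj => //; lia.
(* Quantifying over a finite type lets one [N] serve all the relations. *)
have relN : \forall N \near \oo, forall x : 'I_5 * 'I_5 * ('I_5 * 'I_5),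
    let: (a, b, (c, d)) := x in
    (a < b < 5)%N -> (c < d < 5)%N ->
    [&& a != c :> nat, a != d :> nat, b != c :> nat & b != d :> nat] ->
    W N c a b (+) W N d a b =
    (W N a c d (+) (U c a (+) U d a)) (+) (W N b c d (+) (U c b (+) U d b)).
  apply: filter_forall => -[[a b] [c d]].
  have [ab|] := boolP (a < b < 5)%N; last by move=> _; apply: filterE.
  have [cd|] := boolP (c < d < 5)%N; last by move=> _; apply: filterE.
  have [ne|] := boolP [&& a != c :> nat, a != d :> nat, b != c :> nat & b != d :> nat];
    last by move=> _; apply: filterE.
  by apply: filterS (rel _ _ _ _ ab cd ne).
have [N HN] := filter_ex relN.
apply: (@K5_parity (W N) U) => [a b ab|a b c d ab cd ne].
  rewrite /U -opprB upN // => /eqP; rewrite subr_eq0 => /eqP/finj; apply: vinj; lia.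
have [a5 b5 c5 d5] : [/\ (a < 5)%N, (b < 5)%N, (c < 5)%N & (d < 5)%N] by split; lia.
exact: (HN (Ordinal a5, Ordinal b5, (Ordinal c5, Ordinal d5))).
Qed.

(** * Planarity when components have at most four vertices *)

Section K4Components.
Variable R : realType.

(** Together with [k4y], a straight drawing of K_4: the triangle (0,0), (4,0), (0,4) and its
    interior point (1,1). *)
Definition k4x (a : nat) : R := nth 0 [:: 0; 4; 0; 1] a.
Definition k4y (a : nat) : R := nth 0 [:: 0; 0; 4; 1] a.

Lemma k4x_bounds a : 0 <= k4x a <= 4.
Proof.
by rewrite /k4x; apply/andP; split; case: a => [|[|[|[|a]]]] /=;
  rewrite ?nth_nil; lra.
Qed.

Lemma k4_inj a b : (a < 4)%N -> (b < 4)%N ->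
  k4x a = k4x b -> k4y a = k4y b -> a = b.
Proof.
move=> a4 b4; case: a a4 => [|[|[|[|//]]]] _; case: b b4 => [|[|[|[|//]]]] _ //;
by rewrite /k4x /k4y /= => ? ?; exfalso; lra.
Qed.

Lemma k4_edge_vertex a b c (t : R) : (a < 4)%N -> (b < 4)%N -> (c < 4)%N ->
  a <> b -> 0 <= t <= 1 ->
  k4x a + t * (k4x b - k4x a) = k4x c ->
  k4y a + t * (k4y b - k4y a) = k4y c -> c = a \/ c = b.
Proof.
move=> a4 b4 c4 + /andP[t0 t1].
by case: a a4 => [|[|[|[|//]]]] _; case: b b4 => [|[|[|[|//]]]] _ //;
   case: c c4 => [|[|[|[|//]]]] _ _; rewrite /k4x /k4y /= => h1 h2;
   first [by left|by right|exfalso; lra].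
Qed.

Lemma k4_edge_edge a b c d (t s : R) :
  (a < 4)%N -> (b < 4)%N -> (c < 4)%N -> (d < 4)%N ->
  a <> b -> c <> d -> ~ (a = c /\ b = d) -> ~ (a = d /\ b = c) ->
  0 <= t <= 1 -> 0 <= s <= 1 ->
  k4x a + t * (k4x b - k4x a) = k4x c + s * (k4x d - k4x c) ->
  k4y a + t * (k4y b - k4y a) = k4y c + s * (k4y d - k4y c) ->
  (t = 0 /\ (a = c \/ a = d)) \/ (t = 1 /\ (b = c \/ b = d)).
Proof.
move=> a4 b4 c4 d4 ab cd n1 n2 /andP[t0 t1] /andP[s0 s1].
by case: a a4 ab n1 n2 => [|[|[|[|//]]]] _ ab n1 n2;
   case: b b4 ab n1 n2 => [|[|[|[|//]]]] _ // _ n1 n2;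
   case: c c4 cd n1 n2 => [|[|[|[|//]]]] _ cd n1 n2;
   case: d d4 cd n1 n2 => [|[|[|[|//]]]] _ // _ n1 n2;
   rewrite /k4x /k4y /= => h1 h2;
   first [by case: n1|by case: n2|exfalso; lra
         |by left; split; [lra|auto]|by right; split; [lra|auto]].
Qed.

(** No edge joins two labels of [comp], and [rk] numbers the at most four vertices of one label, so
    each label gets its own drawing of K_4. *)
Lemma planar_K4_components (n : nat) (adj : 'I_n -> 'I_n -> Prop)
    (comp rk : 'I_n -> nat) :
  (forall i, (rk i < 4)%N) -> (forall i j, adj i j -> comp i = comp j) ->
  (forall i j, comp i = comp j -> rk i = rk j -> i = j) -> planar R adj.
Proof.
move=> rk4 adjc rkI.
(* The shift by 5 exceeds the width 4 of one drawing, so different copies do not meet. *)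
pose f i : R * R := (5 * (comp i)%:R + k4x (rk i), k4y (rk i)).
pose gam i j (t : R) : R * R :=
  ((f i).1 + t * ((f j).1 - (f i).1), (f i).2 + t * ((f j).2 - (f i).2)).
have itvP (t : R) : t \in `[0, 1] -> 0 <= t <= 1 by rewrite in_itv.
have gamE i j t : adj i j ->
    gam i j t = (5 * (comp i)%:R + (k4x (rk i) + t * (k4x (rk j) - k4x (rk i))),
                 k4y (rk i) + t * (k4y (rk j) - k4y (rk i))).
  by move=> /adjc e; rewrite /gam /f e; congr pair => /=; ring.
have comp_far i j (x y : R) : 0 <= x <= 4 -> 0 <= y <= 4 ->
    5 * (comp i)%:R + x = 5 * (comp j)%:R + y -> comp i = comp j.
  move=> /andP[x0 x4] /andP[y0 y4] e; case: (ltngtP (comp i) (comp j)) => // lt;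
    by move: lt; rewrite -(ler_nat R) -natr1 => lt; exfalso; lra.
have seg_bounds a b (t : R) : 0 <= t <= 1 ->
    0 <= k4x a + t * (k4x b - k4x a) <= 4.
  move=> /andP[t0 t1]; have /andP[? ?] := k4x_bounds a; have /andP[? ?] := k4x_bounds b.
  by apply/andP; split; nra.
have rk_neq (i j : 'I_n) : (i < j)%N -> adj i j -> rk i <> rk j.
  by move=> ij /adjc e /rkI; move/(_ e) => ije; rewrite ije ltnn in ij.
have finj : injective f.
  move=> i j [e1 e2].
  have ec := comp_far _ _ _ _ (k4x_bounds _) (k4x_bounds _) e1.
  apply: rkI (ec) (k4_inj (rk4 _) (rk4 _) _ e2).
  by move: e1; rewrite ec => /addrI.
exists f, gam; split=> //; split.
- move=> i j ij aij; have ne := rk_neq _ _ ij aij; split.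
  + have cl (a b : R) : continuous (fun t : R => a + t * b).
      by move=> x; apply: cvgD; [exact: cvg_cst|apply: cvgMl; exact: cvg_id].
    apply: continuous_subspaceT => t.
    exact: cvg_pair (cl (f i).1 _ t) (cl (f i).2 _ t).
  + by rewrite /gam !mul0r !addr0 -surjective_pairing.
  + by rewrite /gam !mul1r !(addrC (f i).1) !(addrC (f i).2) !subrK -surjective_pairing.
  + move=> t s /itvP/andP[t0 t1] /itvP/andP[s0 s1]; rewrite !gamE // => -[/addrI].
    move: (rk4 i) (rk4 j) ne; case: (rk i) => [|[|[|[|//]]]] _;
    by case: (rk j) => [|[|[|[|//]]]] _ //; rewrite /k4x /k4y /= => _ ? ?; lra.
  + move=> v t /itvP t1; rewrite gamE // => -[e1 e2].
    have ec := comp_far _ _ _ _ (seg_bounds _ _ _ t1) (k4x_bounds _) e1.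
    move: e1; rewrite ec => /addrI e1.
    have [e|e] := k4_edge_vertex (rk4 _) (rk4 _) (rk4 _) ne t1 e1 e2.
      by left; apply: rkI.
    by right; apply: rkI => //; rewrite -ec; apply: adjc.
- move=> i j k l ij aij kl akl nijkl t s /itvP t1 /itvP s1.
  rewrite !gamE // => -[e1 e2].
  have ec := comp_far _ _ _ _ (seg_bounds _ _ _ t1) (seg_bounds _ _ _ s1) e1.
  move: e1; rewrite ec => /addrI e1; have cij := adjc _ _ aij; have ckl := adjc _ _ akl.
  have n1 : ~ (rk i = rk k /\ rk j = rk l).
    move=> [ik jl]; apply: nijkl; rewrite (rkI i k) // (rkI j l) //.
    by rewrite -cij -ckl.
  have n2 : ~ (rk i = rk l /\ rk j = rk k).
    move=> [il jk]; have [eil ejk] : i = l /\ j = k.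
      by split; apply: rkI => //; rewrite -?ckl -?cij.
    by move: ij; rewrite eil ejk ltnNge ltnW.
  have [[t0 H]|[t0 H]] := k4_edge_edge (rk4 _) (rk4 _) (rk4 _) (rk4 _)
    (rk_neq _ _ ij aij) (rk_neq _ _ kl akl) n1 n2 t1 s1 e1 e2.
    exists i; split; [by left|split].
      by case: H => H; [left|right]; apply: rkI; rewrite // -ckl.
    by rewrite t0 /f !mul0r !addr0 ec.
  exists j; split; [by right|split].
    by case: H => H; [left|right]; apply: rkI; rewrite // -cij // -ckl.
  by rewrite t0 /f !mul1r -cij ec; congr pair; ring.
Qed.

End K4Components.

(** * Deciding planarity from the distances of the points *)

Section GeometricGraph.
Variable R : realType.
Implicit Types (d : R) (p q w : R * R).

Definition box_close d p q := (`|p.1 - q.1| <= d) && (`|p.2 - q.2| <= d).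

Lemma dist2C p q : dist2 p q = dist2 q p.
Proof. by rewrite /dist2 -[p.1 - q.1]opprB -[p.2 - q.2]opprB !sqrrN. Qed.

Lemma dist2_box_close d p q : dist2 p q <= d -> box_close d p q.
Proof.
move=> pq; apply/andP; split; apply: le_trans pq; rewrite -sqrtr_sqr;
  by apply: ler_wsqrtr; rewrite ?lerDl ?lerDr sqr_ge0.
Qed.

Lemma box_close_dist2 d p q : box_close (d / 2) p q -> dist2 p q <= d.
Proof.
rewrite /box_close /dist2 !ler_norml => /andP[/andP[x1 x2] /andP[y1 y2]].
move: (p.1 - q.1) (p.2 - q.2) x1 x2 y1 y2 => x y x1 x2 y1 y2.
have d0 : 0 <= d by lra.
rewrite -[leRHS]ger0_norm // -sqrtr_sqr; apply: ler_wsqrtr; nra.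
Qed.

Lemma box_close_trans d d' q p w :
  box_close d p q -> box_close d' q w -> box_close (d + d') p w.
Proof.
move=> /andP[x1 y1] /andP[x2 y2]; apply/andP; split.
  exact: le_trans (ler_distD q.1 _ _) (lerD x1 x2).
exact: le_trans (ler_distD q.2 _ _) (lerD y1 y2).
Qed.

Lemma box_closeW d d' p q : d <= d' -> box_close d p q -> box_close d' p q.
Proof. by move=> dd' /andP[x y]; apply/andP; split; exact: le_trans dd'. Qed.

(* A vertex reached by a simple path with at least four edges would see five
   vertices within distance [4 * rho]; hence every component has at most four
   vertices. *)
Lemma planar_geom_adj_sparse (n : nat) (r rho : R) (s : seq R) :
  r <= rho -> 0 <= rho ->
  (forall i : 'I_n,
     (#|[pred j : 'I_n | box_close (4 * rho) (point s i) (point s j)]| <= 4)%N) ->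
  planar R (@geom_adj R n r s).
Proof.
move=> le_r rho0 sparse; pose e : rel 'I_n := fun i j => `[< geom_adj r s i j >].
have esym : symmetric e.
  by move=> i j; apply: asbool_equiv_eq; rewrite /geom_adj dist2C; split=> -[/nesym].
have csym : connect_sym e by exact: sym_connect_sym.
have path_close (p : seq 'I_n) : forall x k, path e x p -> (k <= size p)%N ->
    box_close (k%:R * rho) (point s x) (point s (nth x (x :: p) k)).
  elim: p => [|y p IH] x [|k] //=; rewrite ?mul0r ?/box_close ?subrr ?normr0 ?lexx //.
  move=> /andP[/asboolP[_ xy] yp] kp; rewrite -/(box_close _ _ _).
  rewrite -natr1 mulrDl mul1r addrC; apply: (@box_close_trans _ _ (point s y)).
    by apply: dist2_box_close; exact: le_trans le_r.
  by have := IH y k yp kp; case: k kp => //= k kp; rewrite (set_nth_default x).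
have close4 x (p : seq 'I_n) k : path e x p -> (k <= size p)%N -> (k <= 4)%N ->
    box_close (4 * rho) (point s x) (point s (nth x (x :: p) k)).
  move=> xp kp k4; apply: box_closeW (path_close _ _ _ xp kp).
  by rewrite ler_wpM2r // ler_nat.
have comp_close i j : connect e i j -> box_close (4 * rho) (point s i) (point s j).
  move=> /connectP[p0 + ->] => /shortenP[p ip up _].
  have [p4|p4] := leqP (size p) 4.
    by rewrite (last_nth i) close4.
  (* The path is simple, so its first five vertices are distinct, and each is at most four edges
     away from [i]. *)
  have size5 : size (take 5 (i :: p)) = 5 by rewrite size_takel //= ltnS ltnW.
  have : (#|take 5 (i :: p)| <= 4)%N; last by rewrite (card_uniqP (take_uniq _ up)) size5.
  apply: leq_trans (sparse i); apply: subset_leq_card.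
  apply/fintype.subsetP => x /(nthP i)[k]; rewrite size5 => k5 <-.
  by rewrite nth_take // inE close4 // -ltnS (leq_trans k5) // ltnS ltnW.
have comp4 i : (#|connect e i| <= 4)%N.
  apply: leq_trans (sparse i); apply: subset_leq_card; apply/fintype.subsetP => j.
  exact: comp_close.
(* A component is labelled by its canonical root, a vertex by its position in the list of that
   component. *)
apply: (@planar_K4_components R n _ (fun i => nat_of_ord (fingraph.root e i))
  (fun i => index i (enum (connect e (fingraph.root e i))))).
- move=> i; apply: leq_trans (comp4 (fingraph.root e i)); rewrite cardE index_mem mem_enum.
  by rewrite -topredE /= csym connect_root.
- by move=> i j aij; congr nat_of_ord; apply/(fingraph.rootP csym)/connect1/asboolP.
- move=> i j /val_inj rij; rewrite rij => /(congr1 (nth i (enum (connect e (fingraph.root e j))))).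
  by rewrite !nth_index // mem_enum -topredE /= csym ?connect_root // -rij connect_root.
Qed.

Lemma not_planar_geom_adj (n : nat) (r : R) (s : seq R) (A : pred 'I_n) :
  (5 <= #|A|)%N ->
  (forall i j, A i -> A j -> box_close (r / 2) (point s i) (point s j)) ->
  ~ planar R (@geom_adj R n r s).
Proof.
move=> A5 Aclose; have [i0 _] : exists i, i \in A by apply/card_gt0P; exact: leq_trans A5.
pose v k := nth i0 (enum A) k.
have vA k : (k < 5)%N -> A (v k).
  by move=> k5; have := mem_nth i0 (_ : (k < size (enum A))%N);
    rewrite -cardE mem_enum; apply; exact: leq_trans A5.
(* [enum] lists ordinals increasingly, the order that [K5_not_planar] asks for. *)
have srt : sorted ltn (map val (enum A)).
  apply: (@subseq_sorted _ _ ltn_trans _ (map val (enum 'I_n))).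
    by rewrite enumT; exact/map_subseq/filter_subseq.
  by rewrite val_enum_ord iota_ltn_sorted.
have vlt a b : (a < b < 5)%N -> (v a < v b)%N.
  move=> /andP[ab b5]; rewrite -!(nth_map i0 0%N val) -?cardE ?(leq_trans _ A5) //; last exact: ltn_trans b5.
  by apply: (sorted_ltn_nth ltn_trans 0%N srt) => //;
    rewrite inE size_map -cardE (leq_trans _ A5) //; exact: ltn_trans b5.
apply: (@K5_not_planar _ _ _ v) => a b /[dup] ab /vlt lt; split=> //.
split; first by move=> e; rewrite e ltnn in lt.
by apply/box_close_dist2/Aclose; apply: vA; lia.
Qed.
End GeometricGraph.

(** * Occupancy of bins by independent uniform balls *)

Section Average.
Variables (R : realType) (B : finType).
Implicit Types (P Q : seq B -> R) (A : pred B).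

(** The expectation of [P] over [n] independent uniform elements of [B]; the recursion parallels
    that of [cube_int]. *)
Fixpoint avg (n : nat) P : R :=
  match n with
  | 0 => P [::]
  | n'.+1 => (#|B|%:R)^-1 * \sum_(b : B) avg n' (fun s => P (b :: s))
  end.

Lemma avg_ge0 n P : (forall s, 0 <= P s) -> 0 <= avg n P.
Proof.
elim: n P => [|n IH] P P0 /=; first exact: P0.
by rewrite mulr_ge0 ?invr_ge0 // sumr_ge0 // => b _; exact: IH.
Qed.

Lemma le_avg n P Q : (forall s, size s = n -> P s <= Q s) -> avg n P <= avg n Q.
Proof.
elim: n P Q => [|n IH] P Q PQ /=; first exact: PQ.
rewrite ler_wpM2l ?invr_ge0 // ler_sum // => b _.
by apply: IH => s sn; apply: PQ; rewrite /= sn.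
Qed.

Lemma eq_avg n P Q : (forall s, size s = n -> P s = Q s) -> avg n P = avg n Q.
Proof.
by move=> PQ; apply/eqP; rewrite eq_le !le_avg // => s /PQ ->.
Qed.

Lemma avgD n P Q : avg n (fun s => P s + Q s) = avg n P + avg n Q.
Proof.
elim: n P Q => [|n IH] P Q //=; rewrite -mulrDr -big_split /=.
by congr (_ * _); apply: eq_bigr => b _; rewrite IH.
Qed.

Lemma avgZ n c P : avg n (fun s => c * P s) = c * avg n P.
Proof.
elim: n P => [|n IH] P //=; rewrite mulrCA; congr (_ * _); rewrite mulr_sumr.
by apply: eq_bigr => b _; rewrite IH.
Qed.

Lemma avg_sum n (I : finType) (P : I -> seq B -> R) :
  avg n (fun s => \sum_i P i s) = \sum_i avg n (P i).
Proof.
elim: n P => [|n IH] P //=; rewrite -mulr_sumr; congr (_ * _).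
by rewrite exchange_big /=; apply: eq_bigr => b _; rewrite IH.
Qed.

Lemma avg_cat k l P :
  avg (k + l) P = avg k (fun s => avg l (fun t => P (s ++ t))).
Proof.
elim: k P => [|k IH] P //=; congr (_ * _); apply: eq_bigr => b _.
exact: IH.
Qed.

Hypothesis B_gt0 : (0 < #|B|)%N.
Let N : R := #|B|%:R.

Let N_gt0 : 0 < N. Proof. by rewrite ltr0n. Qed.
Let N_neq0 : N != 0. Proof. by rewrite gt_eqF. Qed.

Lemma avg_cst n c : avg n (fun=> c) = c.
Proof.
by elim: n => //= n ->; rewrite sumr_const -[c *+ _]mulr_natl mulKf.
Qed.

Lemma sum_cst (c : R) : \sum_(b : B) c = N * c.
Proof. by rewrite sumr_const mulr_natl. Qed.

Lemma sum_indicator A : \sum_b (A b)%:R = #|A|%:R :> R.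
Proof.
rewrite -sum1_card natr_sum [RHS]big_mkcond; apply: eq_bigr => b _.
by rewrite -[b \in A]/(A b); case: (A b).
Qed.

(** A union bound over [k] balls, by conditioning on the first ball: for p = |A| / N, p (n p)^k + (n
    p)^(k+1) = (n + 1) n^k p^(k+1) <= ((n + 1) p)^(k+1). *)
Lemma avg_count_tail A k n :
  avg n (fun s => (k <= count A s)%N%:R) <= (n%:R * (#|A|%:R / N)) ^+ k.
Proof.
set p := _ / N; have p0 : 0 <= p by rewrite divr_ge0 // ltW.
elim: n k => [|n IH] [|k].
- by [].
- by rewrite /= mul0r expr0n.
- by rewrite (@eq_avg _ _ (fun=> 1)) ?avg_cst.
have bound b : avg n (fun s => (k < count A (b :: s))%N%:R) <=
    (A b)%:R * (n%:R * p) ^+ k + (n%:R * p) ^+ k.+1.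
  have [Ab|nAb] := boolP (A b); rewrite /= ?Ab ?(negbTE nAb) ?add1n ?add0n.
    rewrite mul1r; apply: le_trans (IH k) _.
    by rewrite lerDl exprn_ge0 // mulr_ge0.
  by rewrite mul0r add0r; exact: (IH k.+1).
apply: (@le_trans _ _ (N^-1 * \sum_b ((A b)%:R * (n%:R * p) ^+ k + (n%:R * p) ^+ k.+1))).
  by rewrite /= ler_wpM2l ?invr_ge0 // ler_sum // => b _; exact: bound.
rewrite big_split /= -mulr_suml sum_cst sum_indicator.
have -> : N^-1 * (#|A|%:R * (n%:R * p) ^+ k + N * (n%:R * p) ^+ k.+1) =
    n.+1%:R * n%:R ^+ k * p ^+ k.+1.
  by rewrite /p -natr1 !exprMn !exprS; field; rewrite N_neq0.
rewrite [leRHS]exprMn ler_wpM2r ?exprn_ge0 // exprS ler_wpM2l //.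
by rewrite lerXn2r ?nnegrE // ler_nat.
Qed.

Lemma avg_avoid A n :
  avg n (fun s => (~~ has A s)%:R) = (1 - #|A|%:R / N) ^+ n.
Proof.
elim: n => [|n IH] //=.
under eq_bigr => b _.
  rewrite (@eq_avg _ _ (fun s => (~~ A b)%:R * (~~ has A s)%:R)); last first.
    by move=> s _; rewrite negb_or -mulnb natrM.
  rewrite avgZ IH; over.
rewrite -mulr_suml mulrA exprS; congr (_ * _).
rewrite (eq_bigr (fun b => 1 - (A b)%:R)) => [|b _].
  rewrite sumrB sum_indicator sum_cst.
  by field; rewrite N_neq0.
by case: (A b); rewrite ?subr0 ?subrr.
Qed.

Definition hit (b : B) (s : seq B) : R := (b \in s)%:R.

Definition hit_prob (L : nat) : R := 1 - (1 - N^-1) ^+ L.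

Lemma avg_hit L b : avg L (hit b) = hit_prob L.
Proof.
rewrite (@eq_avg _ _ (fun s => 1 + (-1) * (~~ has (pred1 b) s)%:R)).
  by rewrite avgD avg_cst avgZ avg_avoid card1 mul1r mulN1r.
by move=> s _; rewrite has_pred1 /hit; case: (b \in s); rewrite /= ?mulr0 ?mulr1 ?addr0 ?subrr.
Qed.

(** By inclusion-exclusion the left side is 2 q - 1 + (1 - 2/N)^L, where q is the hit probability,
    and 1 - 2/N <= (1 - 1/N)^2. *)
Lemma avg_hit2 L b b' : b != b' ->
  avg L (fun s => hit b s * hit b' s) <= hit_prob L ^+ 2.
Proof.
move=> bb'.
rewrite (@eq_avg _ _ (fun s => (hit b s + hit b' s - 1)
   + (~~ has (pred2 b b') s)%:R)); last first.
  move=> s _; rewrite /hit.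
  have -> : has (pred2 b b') s = (b \in s) || (b' \in s).
    by rewrite -!has_pred1 -has_predU.
  by case: (b \in s); case: (b' \in s) => /=; ring.
rewrite !avgD !avg_hit avg_cst avg_avoid card2 bb' /hit_prob.
have N2 : 2 <= N.
  rewrite ler_nat (leq_trans _ (max_card (pred2 b b'))) // card2 bb' //.
have : (1 - 2 / N) ^+ L <= ((1 - N^-1) ^+ 2) ^+ L.
  apply: lerXn2r; rewrite ?nnegrE ?sqr_ge0 //.
    by rewrite subr_ge0 ler_pdivrMr // mul1r.
  have : 0 <= N^-1 ^+ 2 by rewrite sqr_ge0.
  by move: N^-1 => x; nra.
rewrite -exprM mulnC exprM; move: (_ ^+ L) (_ ^+ L) => x y; nra.
Qed.

(** For [hit b] this is the indicator that each of [g] disjoint groups of [L] balls meets [b];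
    disjointness makes the factors independent. *)
Fixpoint block_prod (L g : nat) (f : seq B -> R) (s : seq B) : R :=
  if g is g'.+1 then f (take L s) * block_prod L g' f (drop L s) else 1.

Lemma avg_block_prod L g t f : avg (g * L + t) (block_prod L g f) = avg L f ^+ g.
Proof.
elim: g => [|g IH] /=; first by rewrite avg_cst.
rewrite mulSn -addnA avg_cat exprSr -IH -avgZ.
apply: eq_avg => s sL; rewrite mulrC -avgZ.
apply: eq_avg => u _.
by rewrite take_size_cat // drop_size_cat.
Qed.

Lemma block_prodM L g f f' s :
  block_prod L g f s * block_prod L g f' s =
  block_prod L g (fun u => f u * f' u) s.
Proof. by elim: g s => [|g IH] s /=; rewrite ?mulr1 // mulrACA IH. Qed.

Lemma eq_block_prod L g f f' s : f =1 f' -> block_prod L g f s = block_prod L g f' s.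
Proof. by move=> ff'; elim: g s => //= g IH s; rewrite IH ff'. Qed.

Lemma block_prod_hit_count L g b s :
  block_prod L g (hit b) s != 0 -> (g <= count_mem b s)%N.
Proof.
elim: g s => //= g IH s; rewrite mulf_eq0 negb_or => /andP[h /IH gd].
rewrite -(cat_take_drop L s) count_cat.
have : (0 < count_mem b (take L s))%N.
  by rewrite -has_count has_pred1; move: h; rewrite /hit pnatr_eq0 eqb0 negbK.
by move=> c; exact: leq_add c gd.
Qed.

(* Chebyshev's inequality for the number of values hit by all blocks; the
   events for two distinct values are negatively correlated. *)
Lemma avg_no_multiple g L t : (0 < L)%N ->
  avg (g * L + t) (fun s => [forall b, count_mem b s < g]%N%:R) <=
  (N * hit_prob L ^+ g)^-1.
Proof.
move=> L0; set q := hit_prob L; set mu := N * q ^+ g.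
have q0 : 0 < q.
  rewrite /q /hit_prob subr_gt0 exprn_ilt1 ?lt0n_neq0 //.
    by rewrite subr_ge0 invf_le1 // ler1n.
  by rewrite gtrBl invr_gt0.
have mu0 : 0 < mu by rewrite mulr_gt0 // exprn_gt0.
pose Y b := block_prod L g (hit b).
pose X s := \sum_b Y b s.
have EX : avg (g * L + t) X = mu.
  rewrite avg_sum (eq_bigr (fun=> q ^+ g)) => [|b _].
    by rewrite sum_cst.
  by rewrite avg_block_prod avg_hit.
have EX2 : avg (g * L + t) (fun s => X s * X s) <= mu + mu ^+ 2.
  (* For each [b] the diagonal term is q^g, since indicators are idempotent, and each other term is
     at most q^(2g). The surplus term b' = b of the inner sum is dropped. *)
  have -> : mu + mu ^+ 2 = \sum_(b : B) (q ^+ g + \sum_(b' : B) (q ^+ 2) ^+ g).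
    rewrite big_split /= !sum_cst -exprM mulnC exprM.
    by rewrite /mu; ring.
  rewrite (@eq_avg _ _ (fun s => \sum_b \sum_b' Y b s * Y b' s)); last first.
    by move=> s _; rewrite /X mulr_suml; apply: eq_bigr => b _; rewrite mulr_sumr.
  rewrite avg_sum ler_sum // => b _; rewrite avg_sum (bigD1 b) //=.
  apply: lerD.
    rewrite /q -(avg_hit L b) -(avg_block_prod L g t) le_avg // => s _.
    rewrite block_prodM (@eq_block_prod _ _ _ (hit b)) // => u.
    by rewrite /hit; case: (b \in u); rewrite ?mulr0 ?mulr1.
  rewrite [leRHS](bigD1 b) //= -[leLHS]add0r; apply: lerD; first by rewrite exprn_ge0 ?sqr_ge0.
  apply: ler_sum => b' b'b.
  rewrite (@eq_avg _ _ (block_prod L g (fun u => hit b u * hit b' u))).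
    rewrite avg_block_prod lerXn2r ?nnegrE ?sqr_ge0 ?avg_hit2 // 1?eq_sym //.
    by apply: avg_ge0 => u; rewrite mulr_ge0.
  by move=> s _; rewrite block_prodM.
(* The square (X / mu - 1)^2 dominates the indicator: if no value occurs [g] times, then X = 0. *)
apply: (@le_trans _ _ (avg (g * L + t)
    (fun s => mu ^- 2 * (X s * X s) + ((- 2 / mu) * X s + 1)))).
  apply: le_avg => s _.
  have -> : mu ^- 2 * (X s * X s) + ((- 2 / mu) * X s + 1) = (X s / mu - 1) ^+ 2.
    by field; rewrite gt_eqF.
  case: forallP => [H|_] /=; last by rewrite sqr_ge0.
  rewrite /X big1 ?mul0r ?sub0r ?sqrrN ?expr1n // => b _.
  by apply/eqP/negPn/negP => /block_prod_hit_count; rewrite leqNgt H.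
rewrite !avgD !avgZ avg_cst EX.
apply: (@le_trans _ _ (mu ^- 2 * (mu + mu ^+ 2) + ((- 2 / mu) * mu + 1))).
  by rewrite lerD2r ler_wpM2l // invr_ge0 exprn_ge0 // ltW.
rewrite le_eqVlt; apply/orP; left; apply/eqP.
by field; rewrite gt_eqF.
Qed.

(** Bernoulli's inequality 1 + L/N <= (1 + 1/N)^L and (1 - 1/N) (1 + 1/N) <= 1 give (1 - 1/N)^L <= 1
    / (1 + L/N). *)
Lemma hit_prob_ge L : L%:R / (N + L%:R) <= hit_prob L.
Proof.
have NL : 0 < N + L%:R by rewrite ltr_wpDr.
have N1 : 1 <= N by rewrite ler1n.
have -> : L%:R / (N + L%:R) = 1 - (1 + L%:R / N)^-1.
  by field; rewrite N_neq0 gt_eqF.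
rewrite /hit_prob lerD2l lerN2.
have pos : 0 < 1 + L%:R / N by rewrite ltr_wpDr ?divr_ge0.
rewrite -[leRHS]mul1r ler_pdivlMr //.
have bern : 1 + L%:R / N <= (1 + N^-1) ^+ L.
  elim: L {NL pos} => [|L IH]; first by rewrite mul0r addr0 expr0.
  rewrite exprS; apply: le_trans (_ : (1 + N^-1) * (1 + L%:R / N) <= _).
    rewrite -natr1; have : 0 <= L%:R * (N^-1 * N^-1).
      by rewrite mulr_ge0 // mulr_ge0 // invr_ge0.
    by move: N^-1 (L%:R : R) => x l; nra.
  by rewrite ler_wpM2l // addr_ge0 // invr_ge0.
have N1' : 0 <= 1 - N^-1 by rewrite subr_ge0 invf_le1.
apply: le_trans (_ : (1 - N^-1) ^+ L * (1 + N^-1) ^+ L <= _).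
  by rewrite ler_wpM2l ?exprn_ge0.
rewrite -exprMn exprn_ile1 //.
  by rewrite mulr_ge0 // addr_ge0 // invr_ge0.
have : 0 <= N^-1 * N^-1 by rewrite mulr_ge0 // invr_ge0.
by move: N^-1 => x; nra.
Qed.

End Average.

(** * Monotonicity of the iterated integral *)

Section CubeIntegral.
Variable R : realType.
Local Open Scope ereal_scope.
Implicit Types F G : seq R -> \bar R.

(* [ge0_le_integral] without measurability: the integral of a nonnegative
   function is a supremum over the simple functions below it. *)
Lemma ge0_le_integral_nomeas d (T : measurableType d)
    (mu : {measure set T -> \bar R}) (D : set T) (f g : T -> \bar R) :
  (forall x, D x -> 0 <= f x) -> (forall x, D x -> f x <= g x) ->
  \int[mu]_(x in D) f x <= \int[mu]_(x in D) g x.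
Proof.
move=> f0 fg; have g0 x : D x -> 0 <= g x by move=> Dx; exact: le_trans (f0 _ Dx) (fg _ Dx).
rewrite !ge0_integralE //; apply: le_ereal_sup => _ /= [h hf <-].
exists h => // x; apply: le_trans (hf x) _; rewrite /patch; case: ifPn => //.
by rewrite inE => /fg.
Qed.

Lemma cube_int_ge0 k F : (forall s, 0 <= F s) -> 0 <= cube_int k F.
Proof.
elim: k F => [|k IH] F F0 //=; apply: integral_ge0 => x _.
by apply: IH => s; exact: F0.
Qed.

(** Compares the planarity indicator with functions of the cells; only the latter are integrated
    exactly. *)
Lemma le_cube_int k F G : (forall s, 0 <= F s) ->
  (forall s, size s = k -> all [in `[0%R, 1%R]] s -> F s <= G s) ->
  cube_int k F <= cube_int k G.
Proof.
elim: k F G => [|k IH] F G F0 FG /=; first exact: FG.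
apply: ge0_le_integral_nomeas => x x01; first exact: cube_int_ge0.
apply: IH => // s sk s01; apply: FG => /=; first by rewrite sk.
by rewrite s01 andbT.
Qed.

End CubeIntegral.

(** * The grid and the joint law of the cells *)

Section Grid.
Variables (R : realType) (m : nat).
Implicit Types (x y : R) (j : 'I_m.+1).

(** The cap at [m] puts the point 1 into the last cell, which [cell_itv] accordingly closes on the
    right. *)
Definition cell x : 'I_m.+1 := inord (minn (Num.truncn (m.+1%:R * x)) m).

Definition cell_itv j : interval R :=
  Interval (BLeft (j%:R / m.+1%:R)) (BSide (j < m)%N (j.+1%:R / m.+1%:R)).

Lemma cell_itvE x j : x \in `[0, 1] -> (x \in cell_itv j) = (cell x == j).
Proof.
rewrite in_itv /= => /andP[x0 x1]; rewrite in_itv /=.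
have Mx0 : 0 <= m.+1%:R * x by rewrite mulr_ge0.
have M0 : 0 < m.+1%:R :> R by rewrite ltr0n.
have /andP[t1 t2] := truncn_itv Mx0; have jm := ltn_ord j; rewrite ltnS in jm.
have -> : (cell x == j) = (minn (Num.truncn (m.+1%:R * x)) m == j).
  by rewrite -val_eqE /= inordK // ltnS geq_minr.
set t := Num.truncn _ in t1 t2 *.
rewrite ler_pdivrMr // (mulrC x).
have [jlt|jge] := ltnP j m => /=.
  rewrite ltr_pdivlMr // (mulrC x); apply/andP/eqP => [[jx xj]|tj].
    have tj : (t < j.+1)%N by rewrite -(ltr_nat R) (le_lt_trans t1).
    have jt : (j < t.+1)%N by rewrite -(ltr_nat R) (le_lt_trans jx).
    by lia.
  have <- : t = j by lia.
  by [].
have -> : j = m :> nat by lia.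
rewrite divff ?pnatr_eq0 // x1 andbT; apply/idP/eqP => [mx|tm].
  have : (m < t.+1)%N by rewrite -(ltr_nat R) (le_lt_trans mx).
  by lia.
by apply: le_trans t1; rewrite ler_nat; lia.
Qed.

Lemma cell_itv_sub j x : x \in cell_itv j -> x \in `[0, 1].
Proof.
rewrite !in_itv /= => /andP[jx xj]; have jm := ltn_ord j.
apply/andP; split; first by apply: le_trans jx; rewrite divr_ge0.
apply: le_trans (lteifW xj) _; rewrite ler_pdivrMr ?ltr0n // mul1r ler_nat.
exact: jm.
Qed.

Lemma cell_bounds x : x \in `[0, 1] ->
  (cell x)%:R / m.+1%:R <= x <= (cell x).+1%:R / m.+1%:R.
Proof.
move=> x01; have := cell_itvE (cell x) x01; rewrite eqxx in_itv /=.
by move=> /andP[-> /lteifW].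
Qed.

Lemma same_cell_close x y : x \in `[0, 1] -> y \in `[0, 1] ->
  cell x = cell y -> `|x - y| <= m.+1%:R^-1.
Proof.
move=> /cell_bounds + /cell_bounds + e; rewrite e.
have -> : (cell y).+1%:R = (cell y)%:R + 1 :> R by rewrite natr1.
rewrite mulrDl mul1r; 
move: ((cell y)%:R / m.+1%:R : R) (m.+1%:R^-1 : R) => a b.
by move=> /andP[? ?] /andP[? ?]; rewrite ler_norml; apply/andP; split; lra.
Qed.

Lemma close_adjacent_cells x y (d : R) : x \in `[0, 1] -> y \in `[0, 1] ->
  `|x - y| <= d -> d < m.+1%:R^-1 -> (cell y <= (cell x).+1)%N.
Proof.
move=> /cell_bounds/andP[_ x2] /cell_bounds/andP[y1 _].
rewrite ler_norml => /andP[d1 _] dm; rewrite leqNgt; apply/negP => lt.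
have : (cell x).+1%:R / m.+1%:R + m.+1%:R^-1 <= (cell y)%:R / m.+1%:R :> R.
  rewrite -[X in _ + X]mul1r -mulrDl natr1 ler_wpM2r ?invr_ge0 // ler_nat.
  exact: lt.
move: x2 y1 dm d1; 
move: ((cell x).+1%:R / m.+1%:R : R) ((cell y)%:R / m.+1%:R : R) (m.+1%:R^-1 : R).
by move=> a b c *; lra.
Qed.

Local Open Scope ereal_scope.

Lemma lebesgue_measure_cell j :
  lebesgue_measure ([set` cell_itv j] : set R) = (m.+1%:R^-1)%:E.
Proof.
rewrite lebesgue_measure_itv /= lte_fin ltr_pM2r ?invr_gt0 ?ltr0n // ltr_nat ltnSn.
by rewrite -EFinB -mulrBl -natrB // subSnn mul1r.
Qed.

Lemma integral_cell (g : 'I_m.+1 -> R) : (forall j, (0 <= g j)%R) ->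
  \int[lebesgue_measure]_(x in `[0%R, 1%R]) (g (cell x))%:E =
  (m.+1%:R^-1 * \sum_j g j)%:E.
Proof.
move=> g0.
transitivity (\int[@lebesgue_measure R]_(x in `[0%R, 1%R])
    (\sum_j (g j)%:E * (\1_[set` cell_itv j] x)%:E)).
  apply: eq_integral => x; rewrite inE => x01; rewrite (bigD1 (cell x)) //= big1 => [|j jx].
    by rewrite adde0 indicE mem_set ?mule1 //= cell_itvE ?eqxx.
  by rewrite indicE memNset ?mule0 //= cell_itvE // eq_sym; exact/negP.
rewrite ge0_integral_sum //=.
- rewrite mulr_sumr -sumEFin; apply: eq_bigr => j _.
  rewrite ge0_integralZl_EFin //=; last exact/measurable_EFinP/measurable_indic.
  rewrite integral_indic //= setIidl; last by move=> x; exact: cell_itv_sub.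
  by rewrite lebesgue_measure_cell -EFinM mulrC.
- move=> j; apply: emeasurable_funM; first exact: measurable_cst.
  exact/measurable_EFinP/measurable_indic.
- by move=> j x _; rewrite mule_ge0 ?lee_fin.
Qed.

Fixpoint cells (s : seq R) : seq ('I_m.+1 * 'I_m.+1) :=
  if s is x :: y :: s' then (cell x, cell y) :: cells s' else [::].

(** The cells of uniform points are independent and uniform. The induction consumes both coordinates
    of a point at once. *)
Lemma cube_int_cells n (P : seq ('I_m.+1 * 'I_m.+1) -> R) :
  (forall s, (0 <= P s)%R) ->
  cube_int (2 * n) (fun s => (P (cells s))%:E) = (avg n P)%:E.
Proof.
elim: n P => [|n IH] P P0; first by rewrite muln0.
have avg0 j k : (0 <= avg n (fun s => P ((j, k) :: s)))%R by exact: avg_ge0.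
rewrite mulnS /=.
under eq_integral => x _.
  under eq_integral => y _ do rewrite (IH (fun s => P ((cell x, cell y) :: s))) //.
  rewrite (integral_cell (fun k => avg0 (cell x) k)).
  over.
rewrite (@integral_cell (fun j => m.+1%:R^-1 * \sum_k avg n (fun s => P ((j, k) :: s)))%R).
  rewrite -mulr_sumr mulrA pair_bigA /= card_prod card_ord natrM invfM.
  by congr (_ * _)%:E; apply: eq_bigr => -[].
by move=> j; rewrite mulr_ge0 ?invr_ge0 // sumr_ge0.
Qed.

Lemma nth_cells (b : 'I_m.+1 * 'I_m.+1) s n i : size s = (2 * n)%N -> (i < n)%N ->
  nth b (cells s) i = (cell (point s i).1, cell (point s i).2).
Proof.
elim: n s i => // n IH [|x [|y s]] // i; rewrite mulnS // => -[sn].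
case: i => [|i] // lt; rewrite [LHS](IH s i sn lt) /point.
by have -> : (2 * i.+1 = (2 * i).+2)%N by lia.
Qed.

Lemma size_cells s n : size s = (2 * n)%N -> size (cells s) = n.
Proof.
elim: n s => [|n IH] [|x [|y s]] //; rewrite mulnS // => -[sn] /=.
by rewrite (IH s sn).
Qed.

End Grid.

(** * Bounds on the probability for a fixed grid *)

Section Probability.
Variables (R : realType) (m : nat).
Let bin : finType := ('I_m.+1 * 'I_m.+1)%type.
Let N : R := m.+1%:R ^+ 2.
Local Notation cells := (@cells R m).

Let card_bin : #|bin|%:R = N :> R.
Proof. by rewrite card_prod card_ord natrM. Qed.

Let bin_gt0 : (0 < #|bin|)%N.
Proof. by rewrite card_prod card_ord. Qed.

Lemma count_cells (A : pred bin) (s : seq R) n : size s = (2 * n)%N ->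
  count A (cells s) =
  #|[pred i : 'I_n | A (cell m (point s i).1, cell m (point s i).2)]|.
Proof.
move=> sn; pose b0 : bin := (ord0, ord0).
rewrite -[cells s](mkseq_nth b0) (size_cells m sn) /mkseq -val_enum_ord -map_comp.
rewrite count_map cardE [in RHS]/enum_mem size_filter -enumT; apply: eq_count => i /=.
by rewrite (nth_cells b0 sn).
Qed.

Lemma point_in s n i : size s = (2 * n)%N -> all [in `[0%R, 1%R]] s -> (i < n)%N ->
  ((point s i).1 : R) \in `[0, 1] /\ (point s i).2 \in `[0, 1].
Proof.
move=> sn /(all_nthP 0) s01 lt; split; apply: s01; rewrite sn; lia.
Qed.

Definition near_ord (i j : 'I_m.+1) := (j <= i.+1)%N && (i <= j.+1)%N.
(** The 3 x 3 block around [b], cut off at the boundary of the square. *)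
Definition near_bin (b c : bin) := near_ord b.1 c.1 && near_ord b.2 c.2.

Lemma card_near_bin b : (#|near_bin b| <= 9)%N.
Proof.
have card3 i : (#|near_ord i| <= 3)%N.
  apply: leq_trans (card_size [:: inord i.-1; i; inord i.+1]).
  apply: subset_leq_card; apply/fintype.subsetP => j.
  rewrite -[j \in _]/(near_ord i j) => /andP[ji ij]; rewrite !inE -!val_eqE /=.
  have [jm im] := (ltn_ord j, ltn_ord i).
  rewrite (@inordK _ i.-1); last by lia.
  (* [inord i.+1] is out of range for i = m, so it is evaluated only when [i.+1] equals [j]. *)
  have [e|ne] := eqVneq (j : nat) i.+1; last by lia.
  by rewrite inordK -e // eqxx !orbT.
apply: leq_trans (_ : #|[predX near_ord b.1 & near_ord b.2]| <= 9)%N.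
  by apply: subset_leq_card; apply/fintype.subsetP => -[].
by rewrite cardX (leq_mul (card3 _) (card3 _)).
Qed.

(** Cells longer than 4 rho confine the points close to a given one to its block of at most nine
    cells; a union bound over the [N] blocks follows. *)
Lemma prob_planar_ge n (r rho : R) :
  r <= rho -> 0 <= rho -> 4 * rho < m.+1%:R^-1 ->
  ((1 - N * (n%:R * (9 / N)) ^+ 5)%:E <= prob_planar n r)%E.
Proof.
move=> r_rho rho0 small; pose P s : R := (~~ [exists b, 5 <= count (near_bin b) s]%N)%:R.
have N0 : 0 < N by rewrite exprn_gt0 ?ltr0n.
apply: (@le_trans _ _ (avg n P)%:E).
  rewrite lee_fin.
  (* The indicator that no block is crowded is at least 1 minus the number of crowded blocks. *)
  apply: (@le_trans _ _ (avg n (fun s => 1 + (-1) *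
      \sum_(b : bin) (5 <= count (near_bin b) s)%N%:R))); last first.
    apply: le_avg => s _; rewrite /P mulN1r; case: existsP => [[b hb]|_] /=.
      rewrite subr_le0 (bigD1 b) //= hb lerDl sumr_ge0 //.
    by rewrite gerBl sumr_ge0.
  rewrite avgD avg_cst // avgZ avg_sum mulN1r lerD2l lerN2.
  apply: (@le_trans _ _ (\sum_(b : bin) (n%:R * (9 / N)) ^+ 5)).
    apply: ler_sum => b _; apply: le_trans (avg_count_tail R bin_gt0 _ _ _) _.
    rewrite card_bin lerXn2r ?nnegrE ?mulr_ge0 ?invr_ge0 ?(ltW N0) //.
    by rewrite ler_wpM2l // ler_wpM2r ?invr_ge0 ?(ltW N0) // ler_nat card_near_bin.
  by rewrite sumr_const -[X in X <= _]mulr_natl card_bin.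
rewrite -cube_int_cells /P => [|s //]; apply: le_cube_int => [s|s sn s01].
  by rewrite lee_fin.
rewrite lee_fin indicE; case: existsP => //= sparse; rewrite mem_set //=.
apply: planar_geom_adj_sparse r_rho rho0 _ => i.
rewrite leqNgt; apply/negP => five; apply: sparse.
exists (cell m (point s i).1, cell m (point s i).2).
rewrite (count_cells _ sn); apply: leq_trans five _; apply: subset_leq_card.
apply/fintype.subsetP => j; rewrite !inE => /andP[c1 c2].
have [i1 i2] := point_in sn s01 (ltn_ord i).
have [j1 j2] := point_in sn s01 (ltn_ord j).
rewrite /near_bin /near_ord /=.
rewrite !(close_adjacent_cells _ _ _ small) //; by rewrite distrC.
Qed.

(** Chebyshev's inequality with five groups of [L] points bounds the probability by the inverse of N
    (L / (N + L))^5. *)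
Lemma prob_planar_le n (r : R) L : (0 < L)%N -> (5 * L <= n)%N ->
  m.+1%:R^-1 <= r / 2 ->
  (prob_planar n r <= (32 * (N ^+ 4 / L%:R ^+ 5 + N^-1))%:E)%E.
Proof.
move=> L0 Ln fine_grid; pose P s : R := [forall b : bin, count_mem b s < 5]%N%:R.
have N0 : 0 < N by rewrite exprn_gt0 ?ltr0n.
have l0 : 0 < L%:R :> R by rewrite ltr0n.
apply: (@le_trans _ _ (avg n P)%:E); last first.
  rewrite lee_fin -(subnKC Ln); apply: le_trans (avg_no_multiple R bin_gt0 _ _ L0) _.
  rewrite card_bin.
  have q0 : 0 < L%:R / (N + L%:R) by rewrite divr_gt0 // addr_gt0.
  have := hit_prob_ge R bin_gt0 L; rewrite card_bin => hq.
  have hq0 := lt_le_trans q0 hq.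
  apply: (@le_trans _ _ (N * (L%:R / (N + L%:R)) ^+ 5)^-1).
    rewrite lef_pV2 ?posrE; first last.
    - exact: mulr_gt0 N0 (exprn_gt0 5 q0).
    - exact: mulr_gt0 N0 (exprn_gt0 5 hq0).
    rewrite ler_wpM2l ?(ltW N0) // lerXn2r ?nnegrE ?(ltW q0) ?(ltW hq0) //.
  have -> : (N * (L%:R / (N + L%:R)) ^+ 5)^-1 = (N + L%:R) ^+ 5 / (N * L%:R ^+ 5).
    by field; rewrite !gt_eqF // addr_gt0.
  have -> : 32 * (N ^+ 4 / L%:R ^+ 5 + N^-1) =
      32 * (N ^+ 5 + L%:R ^+ 5) / (N * L%:R ^+ 5).
    by field; rewrite !gt_eqF.
  rewrite ler_wpM2r ?invr_ge0 ?mulr_ge0 ?exprn_ge0 ?(ltW N0) ?(ltW l0) //.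
  move: (L%:R : R) l0 => l l0.
  (* The factor 32 is 2^5, from a + b <= 2 b. *)
  have max_bound (a b : R) : 0 <= a -> a <= b -> (a + b) ^+ 5 <= 32 * (a ^+ 5 + b ^+ 5).
    move=> a0 ab; apply: (@le_trans _ _ ((2 * b) ^+ 5)).
      by rewrite lerXn2r ?nnegrE; lra.
    rewrite exprMn mulrDr; have -> : 2 ^+ 5 = 32 :> R by ring.
    by rewrite lerDr mulr_ge0 // exprn_ge0.
  case: (leP N l) => [|/ltW] le; first by apply: max_bound; rewrite // ltW.
  by rewrite addrC (addrC (N ^+ 5)); apply: max_bound; rewrite // ltW.
rewrite -cube_int_cells /P => [|s //]; apply: le_cube_int => [s|s sn s01].
  by rewrite lee_fin.
rewrite lee_fin indicE; case: forallP => /= [_|]; first by case: (_ \in _).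
move=> /existsNP[b /negP]; rewrite -leqNgt (count_cells _ sn) => five.
rewrite memNset //=; apply: not_planar_geom_adj five _ => i j /eqP ib /eqP jb.
have [i1 i2] := point_in sn s01 (ltn_ord i).
have [j1 j2] := point_in sn s01 (ltn_ord j).
have [e1 e2] : cell m (point s i).1 = cell m (point s j).1 /\
    cell m (point s i).2 = cell m (point s j).2.
  by move: ib; rewrite -jb => -[].
by apply/andP; split; apply: le_trans (same_cell_close _ _ _) fine_grid.
Qed.

End Probability.

(** * Passage to the limit on both sides of the threshold *)

Section Threshold.
Variables (R : realType) (r : nat -> R).

Lemma prob_planar_bounds n (d : R) : (0%:E <= prob_planar n d <= 1%:E)%E.
Proof.
apply/andP; split; first by apply: cube_int_ge0 => s; rewrite lee_fin.
(* The integral of the constant 1 is evaluated on the grid with a single cell. *)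
have <- : avg n (fun _ : seq ('I_1 * 'I_1) => 1) = 1 :> R.
  by apply: avg_cst; rewrite card_prod card_ord.
rewrite -cube_int_cells //; apply: le_cube_int => [s|s _ _].
  by rewrite lee_fin.
by rewrite lee_fin indicE; case: (_ \in _).
Qed.

Lemma prob_planar_cvg (l : R) :
  (forall e : R, 0 < e -> \forall n \near \oo,
     ((l - e)%:E <= prob_planar n (r n) <= (l + e)%:E)%E) ->
  (fun n => prob_planar n (r n)) @ \oo --> l%:E.
Proof.
move=> H; have fin n : prob_planar n (r n) \is a fin_num.
  have /andP[p0 p1] := prob_planar_bounds n (r n).
  by rewrite fin_numE gt_eqF ?lt_eqF // ?(le_lt_trans p1) ?(lt_le_trans _ p0) ?ltry ?ltNyr.
apply/fine_cvgP; split; first by apply: filterE.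
apply/cvgrPdist_le => e e0; apply: filterS (H e e0) => n /=.
rewrite -(fineK (fin n)) !lee_fin /= => /andP[h1 h2].
by rewrite ler_norml; apply/andP; split; lra.
Qed.

Local Notation x n := ((n%:R : R) `^ (- (5 / 8))).

Lemma threshold_gt0 n : (0 < n)%N -> 0 < x n.
Proof. by move=> n0; rewrite powR_gt0 // ltr0n. Qed.

(** This identity makes 5/8 critical: five points count as n^5, and the grid contributes the eighth
    power of the cell side. *)
Lemma threshold_expr8 n : (0 < n)%N -> n%:R ^+ 5 * x n ^+ 8 = 1.
Proof.
move=> n0; have n0R : 0 < n%:R :> R by rewrite ltr0n.
rewrite -(powR_mulrn _ (ltW (threshold_gt0 n0))) -powRrM.
have -> : - (5 / 8) * 8%:R = - (5%:R) :> R by field.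
by rewrite powRN powR_mulrn ?ltW // divff // gt_eqF // exprn_gt0.
Qed.

Lemma threshold_le1 n : (0 < n)%N -> x n <= 1.
Proof.
move=> n0; rewrite powRN invf_le1 ?powR_gt0 ?ltr0n //.
have h : 0 <= 5 / 8 :> R by lra.
by have := @ge0_ler_powR R _ h 1 n%:R; rewrite powR1; apply; rewrite ?nnegrE ?ler1n.
Qed.

Lemma prob_planar_cvg1 : (fun n => r n / x n) @ \oo --> (0 : R) ->
  (fun n => prob_planar n (r n)) @ \oo --> (1 : R)%:E.
Proof.
move=> rx; apply: prob_planar_cvg => e e0.
(* Nine cells per block, to the fifth power, and cells of side at most 8 rho, to the eighth. *)
pose C : R := 9 ^+ 5 * 8 ^+ 8.
have C0 : 0 < C by rewrite mulr_gt0 // exprn_gt0.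
(* The bound 1/16 leaves room for rounding the number of cells; e / C yields C c^8 <= e. *)
pose c := Num.min (16^-1) (e / C).
have c0 : 0 < c by rewrite lt_min invr_gt0 ltr0n /= divr_gt0.
have c16 : c <= 16^-1 by rewrite ge_min lexx.
have cC : C * c ^+ 8 <= e.
  rewrite mulrC -ler_pdivlMr //; apply: (@le_trans _ _ c); last by rewrite ge_min lexx orbT.
  rewrite exprS ler_piMr ?(ltW c0) // exprn_ile1 ?(ltW c0) //; lra.
near=> n; have n0 : (0 < n)%N by near: n; exact: nbhs_infty_gt.
have x0 := threshold_gt0 n0.
apply/andP; split; last first.
  have /andP[_ p1] := prob_planar_bounds n (r n).
  by apply: le_trans p1 _; rewrite lee_fin lerDl ltW.
(* Unlike [r n], this scale is certainly positive. *)
pose rho := c * x n.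
have rho0 : 0 < rho by rewrite mulr_gt0.
have rho16 : rho <= 16^-1.
  by apply: le_trans c16; rewrite ler_piMr ?(ltW c0) // threshold_le1.
have r_rho : r n <= rho.
  rewrite -ler_pdivrMr //; apply: ltW; near: n.
  exact: (cvgr_lt _ rx _ c0).
(* The side of the [m.+1] cells lies between 4 rho and 8 rho, because (8 rho)^(-1) > 1. *)
pose m := Num.truncn (8 * rho)^-1.
have rho8 : 0 < 8 * rho by rewrite mulr_gt0.
have /andP[m1 m2] : m%:R <= (8 * rho)^-1 < m.+1%:R.
  by apply: truncn_itv; rewrite invr_ge0 ltW.
have M0 : 0 < m.+1%:R :> R by rewrite ltr0n.
have small : 4 * rho < m.+1%:R^-1.
  rewrite -[ltLHS]invrK ltf_pV2 ?posrE ?invr_gt0 ?mulr_gt0 //.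
  rewrite -natr1; apply: (@le_lt_trans _ _ ((8 * rho)^-1 + 1)); first by rewrite lerD2r.
  have -> : (4 * rho)^-1 = (8 * rho)^-1 + (8 * rho)^-1 by field; rewrite gt_eqF.
  rewrite ltrD2l -[ltLHS]invr1 ltf_pV2 ?posrE //; lra.
apply: le_trans (prob_planar_ge n r_rho (ltW rho0) small); rewrite lee_fin lerD2l lerN2.
apply: le_trans cC.
set M : R := m.+1%:R in m2 M0 *.
have -> : M ^+ 2 * (n%:R * (9 / M ^+ 2)) ^+ 5 = 9 ^+ 5 * (n%:R ^+ 5 * M^-1 ^+ 8).
  by field; rewrite gt_eqF.
rewrite /C -mulrA ler_wpM2l ?exprn_ge0 //.
have M8 : M^-1 <= 8 * rho.
  by rewrite -[leRHS]invrK lef_pV2 ?posrE ?invr_gt0 // ltW.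
have {}M8 : M^-1 ^+ 8 <= (8 * rho) ^+ 8.
  by rewrite lerXn2r ?nnegrE ?invr_ge0 ?(ltW M0) ?(ltW rho8).
apply: (@le_trans _ _ (n%:R ^+ 5 * (8 * rho) ^+ 8)).
  by rewrite ler_wpM2l // exprn_ge0.
rewrite /rho !exprMn; have := threshold_expr8 n0; move: (x n ^+ 8) (n%:R ^+ 5) => y z yz.
by rewrite le_eqVlt; apply/orP; left; apply/eqP; rewrite -[RHS]mulr1 -yz; ring.
Unshelve. all: by end_near. Qed.

Lemma leq_mul_div5 n : (8 <= n)%N -> (n <= 10 * (n %/ 5))%N.
Proof. lia. Qed.

Lemma prob_planar_cvg0 : r @ \oo --> (0 : R) ->
  (fun n => r n / x n) @ \oo --> +oo ->
  (fun n => prob_planar n (r n)) @ \oo --> (0 : R)%:E.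
Proof.
move=> r_to0 rx; apply: prob_planar_cvg => e e0.
(* From M <= 4 / d and n <= 10 L; 64 is twice the factor 32, since each of the two error terms gets
   e / 2. *)
pose C : R := 64 * 4 ^+ 8 * 10 ^+ 5.
have C0 : 0 < C by rewrite !mulr_gt0 ?exprn_gt0.
pose K := Num.max 1 (C / e).
have K1 : 1 <= K by rewrite le_max lexx.
have K0 : 0 < K by apply: lt_le_trans K1.
have CK : C / K ^+ 8 <= e.
  rewrite ler_pdivrMr ?exprn_gt0 ?(lt_le_trans ltr01) // mulrC -ler_pdivrMr //.
  apply: (@le_trans _ _ K); first by rewrite le_max lexx orbT.
  by rewrite exprS ler_peMr ?(le_trans ler01) // exprn_ege1.
near=> n; have n8 : (8 <= n)%N by near: n; exact: nbhs_infty_ge.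
have n0 : (0 < n)%N by apply: leq_trans n8.
have x0 := threshold_gt0 n0.
apply/andP; split.
  have /andP[p0 _] := prob_planar_bounds n (r n).
  by apply: le_trans p0; rewrite lee_fin sub0r oppr_le0 ltW.
have r_big : K * x n <= r n.
  by rewrite -ler_pdivlMr //; near: n; exact: ((cvgryPge _).1 rx).
have rK : 0 < r n by apply: lt_le_trans r_big; rewrite mulr_gt0 // (lt_le_trans ltr01).
have r1 : r n <= 1.
  by apply: ltW; near: n; exact: (cvgr_lt _ r_to0 _ ltr01).
(* With d <= 1 this gives 32 (d / 2)^2 <= 8 d <= e / 2. *)
have re : r n <= e / 16.
  by apply: ltW; near: n; apply: (cvgr_lt _ r_to0); rewrite divr_gt0.
set d := r n in r_big rK r1 re *.
pose m := Num.truncn (2 / d).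
have /andP[m1 m2] : m%:R <= 2 / d < m.+1%:R.
  by apply: truncn_itv; rewrite divr_ge0 // ltW.
have M0 : 0 < m.+1%:R :> R by rewrite ltr0n.
have fine_grid : m.+1%:R^-1 <= d / 2.
  by rewrite -[leRHS]invrK lef_pV2 ?posrE ?invr_gt0 ?divr_gt0 // invf_div ltW.
have M_le : m.+1%:R <= 4 / d.
  rewrite -natr1; have -> : 4 / d = 2 / d + 2 / d by field; rewrite gt_eqF.
  by apply: lerD => //; rewrite ler_pdivlMr //; lra.
pose L := (n %/ 5)%N.
have L0 : (0 < L)%N by rewrite /L divn_gt0 //; apply: leq_trans n8.
have Ln : (5 * L <= n)%N by rewrite mulnC leq_divM.
have nL : n%:R <= 10 * L%:R :> R by rewrite -natrM ler_nat; exact: leq_mul_div5.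
have l0 : 0 < L%:R :> R by rewrite ltr0n.
apply: le_trans (prob_planar_le L0 Ln fine_grid) _; rewrite lee_fin add0r.
set M : R := m.+1%:R in m2 M0 fine_grid M_le *.
have part2 : 32 * (M ^+ 2)^-1 <= e / 2.
  rewrite -exprVn; have : M^-1 ^+ 2 <= (d / 2) ^+ 2.
    by rewrite lerXn2r ?nnegrE ?invr_ge0 ?divr_ge0 ?(ltW M0) ?(ltW rK).
  by move: (M^-1 ^+ 2) => y; nra.
have n5 : n%:R ^+ 5 <= 10 ^+ 5 * L%:R ^+ 5 :> R.
  by rewrite -exprMn lerXn2r ?nnegrE ?mulr_ge0.
have M8 : M ^+ 8 * d ^+ 8 <= 4 ^+ 8.
  rewrite -exprMn lerXn2r ?nnegrE ?mulr_ge0 ?(ltW M0) ?(ltW rK) //.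
  by rewrite -ler_pdivlMr.
have d8 : K ^+ 8 * x n ^+ 8 <= d ^+ 8.
  rewrite -exprMn lerXn2r ?nnegrE ?mulr_ge0 ?(ltW x0) ?(ltW rK) //.
  exact: le_trans K1.
have part1 : 32 * ((M ^+ 2) ^+ 4 / L%:R ^+ 5) <= e / 2.
  rewrite -exprM.
  suff : M ^+ 8 * K ^+ 8 <= 4 ^+ 8 * 10 ^+ 5 * L%:R ^+ 5.
    set A := 4 ^+ 8 * 10 ^+ 5 => MK.
    have : M ^+ 8 / L%:R ^+ 5 <= A / K ^+ 8.
      by rewrite ler_pdivrMr ?exprn_gt0 // mulrAC ler_pdivlMr ?exprn_gt0.
    have : C / K ^+ 8 = 64 * (A / K ^+ 8) by rewrite /C /A !mulrA.
    by move: CK; move: (C / _) (A / _) (M ^+ 8 / _) => u v w *; lra.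
  (* Here K^8 = K^8 x^8 n^5 <= d^8 n^5; then M d <= 4 and n <= 10 L are used. *)
  apply: (@le_trans _ _ (M ^+ 8 * (d ^+ 8 * n%:R ^+ 5))).
    rewrite ler_wpM2l ?exprn_ge0 ?(ltW M0) //.
    apply: (@le_trans _ _ (K ^+ 8 * x n ^+ 8 * n%:R ^+ 5)).
      by rewrite -mulrA [x n ^+ 8 * _]mulrC threshold_expr8 // mulr1.
    by rewrite ler_wpM2r // exprn_ge0.
  rewrite mulrA; apply: (@le_trans _ _ (4 ^+ 8 * n%:R ^+ 5)).
    by rewrite ler_wpM2r // exprn_ge0.
  by rewrite -mulrA ler_wpM2l // exprn_ge0.
by rewrite mulrDr [leRHS]splitr lerD.
Unshelve. all: by end_near. Qed.

End Threshold.

Theorem theorem5 (R : realType) (r : nat -> R) :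
  r @ \oo --> (0 : R) ->
  ((fun n : nat => r n / (n%:R `^ (- (5 / 8 : R)))) @ \oo --> (0 : R) ->
     (fun n : nat => prob_planar n (r n)) @ \oo --> (1%:E : \bar R)) /\
  ((fun n : nat => r n / (n%:R `^ (- (5 / 8 : R)))) @ \oo --> +oo ->
     (fun n : nat => prob_planar n (r n)) @ \oo --> (0%:E : \bar R)).
Proof.
move=> r_to0; split; first exact: prob_planar_cvg1.
exact: prob_planar_cvg0.
Qed.
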